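(* Every $(2,k,v)$-Steiner system generates an equiangular tight frame consisting of $N=v\left(1+\frac{v-1}{k-1}\right)$ vectors in $M=\frac{v(v-1)}{k(k-1)}$-dimensional space with redundancy $\frac{N}{M}=k\left(1+\frac{k-1}{v-1}\right)$ and density $\frac{k}{v}=\left(\frac{N-1}{M(N-M)}\right)^{1/2}$. Moreover, if there exists a real Hadamard matrix of size $1+\frac{v-1}{k-1}$, then the frame can be taken real. Specifically, an $M\times N$ equiangular tight frame matrix $\Phi$ with these properties is obtained by the following construction, whatever choices are made in it: 1. Let $A^{\mathrm T}$ be the $\frac{v(v-1)}{k(k-1)}\times v$ transpose of the $\{0,1\}$-incidence matrix of a $(2,k,v)$-Steiner system. 2. For each $j=1,\dots,v$, let $H_j$ be any $\left(1+\frac{v-1}{k-1}\right)\times\left(1+\frac{v-1}{k-1}\right)$ matrix that has orthogonal rows and unimodular entries (for example a possibly complex Hadamard matrix). 3. For each $j=1,\dots,v$, let $\Phi_j$ be the $\frac{v(v-1)}{k(k-1)}\times\left(1+\frac{v-1}{k-1}\right)$ matrix obtained from the $j$th column of $A^{\mathrm T}$ by replacing each of the one-valued entries with a distinct row of $H_j$, and every zero-valued entry with a row of zeros. 4. Concatenate and rescale the $\Phi_j$'s to form $\Phi=\left(\frac{k-1}{v-1}\right)^{1/2}[\Phi_1\cdots\Phi_v]$.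
   Context: A $(2,k,v)$-Steiner system ($2\le k\le v$) is a $v$-element set $V$ together with a collection $\mathcal B$ of size-$k$ subsets of $V$ (blocks) such that every $2$-element subset of $V$ is contained in exactly one block. Then every element of $V$ lies in exactly $\frac{v-1}{k-1}$ blocks and there are $\frac{v(v-1)}{k(k-1)}$ blocks. The incidence matrix $A$ has rows indexed by $V$ and columns indexed by blocks, with entry $1$ if the block contains the point and $0$ otherwise. An $M\times N$ (real or complex) matrix $\Phi=[\varphi_1\cdots\varphi_N]$ is an equiangular tight frame if its rows are nonzero, have equal norm and are pairwise orthogonal, its columns have unit norm, and $|\langle\varphi_n,\varphi_{n'}\rangle|$ is the same for all $n\neq n'$. Its redundancy is $N/M$. The density of a matrix is the ratio of the number of its nonzero entries to the total number of its entries. A real Hadamard matrix is a square matrix with entries $\pm1$ and orthogonal rows; a complex Hadamard matrix is a square matrix with unimodular complex entries and orthogonal rows. *)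

(* Defs.v *)
From HB Require Import structures.
From mathcomp Require Import all_boot all_order all_algebra.
From mathcomp Require Import complex.
From mathcomp Require Import reals.

Set Implicit Arguments.
Unset Strict Implicit.
Unset Printing Implicit Defensive.

Import Order.TTheory GRing.Theory Num.Theory.
Local Open Scope ring_scope.

Definition steiner_system (k v : nat) (V : finType) (B : {set {set V}}) : Prop :=
  [/\ (2 <= k <= v)%N,
      #|V| = v,
      forall b, b \in B -> #|b| = k
    & forall e : {set V}, #|e| = 2 -> exists! b, b \in B /\ e \subset b].

(* The points and the blocks carry no canonical order, so an incidence matrix
   depends on an enumeration of each; both enumerations are arbitrary. *)
Definition incidence_matrix (V : finType) (B : {set {set V}}) (v M : nat)
    (A : 'M[nat]_(v, M)) : Prop :=
  exists (pt : 'I_v -> V) (bl : 'I_M -> {set V}),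
    [/\ bijective pt,
        injective bl,
        (forall b, b \in B <-> exists i, bl i = b)
      & A = \matrix_(j, i) nat_of_bool (pt j \in bl i)].

Definition density (R : numFieldType) (K : nmodType) (M N : nat)
    (Phi : 'M[K]_(M, N)) : R :=
  #|[set p : 'I_M * 'I_N | Phi p.1 p.2 != 0]|%:R / (M * N)%:R.

(* The entries are real, so there is no conjugation in the row products. *)
Definition real_hadamard (R : numDomainType) (n : nat) (H : 'M[R]_n) : Prop :=
  (forall i l, H i l = 1 \/ H i l = -1) /\
  (forall i i', i != i' -> \sum_l H i l * H i' l = 0).

Section Frames.
Variable C : numClosedFieldType.

(* [dotmx u v] is the Hermitian product of the row vectors u and v, conjugated
   in v; columns are therefore transposed before it is applied to them. *)
Definition l2norm (n : nat) (u : 'rV[C]_n) : C := sqrtC (dotmx u u).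

Definition equiangular_tight_frame (M N : nat) (Phi : 'M[C]_(M, N)) : Prop :=
  [/\ forall i, row i Phi != 0,
      forall i i', l2norm (row i Phi) = l2norm (row i' Phi),
      forall i i', i != i' -> dotmx (row i Phi) (row i' Phi) = 0,
      forall n, l2norm (col n Phi)^T = 1
    & exists c : C, forall n n', n != n' ->
        `|dotmx (col n Phi)^T (col n' Phi)^T| = c].

Definition complex_hadamard (n : nat) (H : 'M[C]_n) : Prop :=
  (forall i l, `|H i l| = 1) /\
  (forall i i', i != i' -> dotmx (row i H) (row i' H) = 0).

(* s i is the index of the row of H that replaces the i-th entry of c when that
   entry is 1; the other values of s are irrelevant. *)
Definition substitute_rows (M n : nat) (c : 'cV[nat]_M) (s : 'I_M -> 'I_n)
    (H : 'M[C]_n) : 'M[C]_(M, n) :=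
  \matrix_(i, l) if c i 0 == 1%N then H (s i) l else 0.

Definition distinct_rows (M n : nat) (c : 'cV[nat]_M) (s : 'I_M -> 'I_n) : Prop :=
  {in [pred i | c i 0 == 1%N] &, injective s}.

Lemma sum_const_ord (v n : nat) : (\sum_(j < v) n = v * n)%N.
Proof. by rewrite sum_nat_const card_ord. Qed.

(* [\mxrow] has \sum_(j < v) n columns; the cast makes this v * n. *)
Definition concatenate (v M n : nat) (Phi_ : 'I_v -> 'M[C]_(M, n)) :
    'M[C]_(M, v * n) :=
  castmx (erefl M, sum_const_ord v n) (\mxrow_(j < v) Phi_ j).

Definition steiner_construction (k v M n : nat) (A : 'M[nat]_(v, M))
    (H : 'I_v -> 'M[C]_n) (Phi : 'M[C]_(M, v * n)) : Prop :=
  exists s : 'I_v -> 'I_M -> 'I_n,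
    (forall j, distinct_rows (col j A^T) (s j)) /\
    Phi = sqrtC ((k%:R - 1) / (v%:R - 1))
            *: concatenate (fun j => substitute_rows (col j A^T) (s j) (H j)).

Definition steiner_generates (k v M n : nat) (V : finType) (B : {set {set V}})
    (Phi : 'M[C]_(M, v * n)) : Prop :=
  exists (A : 'M[nat]_(v, M)) (H : 'I_v -> 'M[C]_n),
    [/\ incidence_matrix B A,
        forall j, complex_hadamard (H j)
      & steiner_construction k A H Phi].

End Frames.

(* Main.v *)
Require Import Defs.
From HB Require Import structures.
From mathcomp Require Import all_boot all_order all_algebra.
From mathcomp Require Import complex.
From mathcomp Require Import reals.
From mathcomp Require Import cyclic separable cyclotomic.
From mathcomp Require Import ring lra zify.

Set Implicit Arguments.
Unset Strict Implicit.
Unset Printing Implicit Defensive.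

Import Order.TTheory GRing.Theory Num.Theory.
Local Open Scope ring_scope.

(** The columns of [Phi] come in v groups, one for each point, and its rows are
the blocks.  Two elementary facts about a Steiner system do all the work: each
point lies on r = (v - 1) / (k - 1) blocks, and two distinct points lie on
exactly one common block ([steiner_parameters], [incidence_design]).

- Rows.  The inner product of two rows splits into a sum over the points common
  to both blocks.  For distinct blocks each summand is the product of two
  different rows of one Hadamard matrix, hence zero.  For a single block, the k
  points contribute r + 1 unimodular terms each.

- Columns of different groups.  Only the one block through both points
  contributes, and it contributes a product of two unimodular numbers.

- Columns of the same group.  The blocks through the point use r of the r + 1
  rows of the Hadamard matrix.  Two columns of the complete matrix are
  orthogonal, since a square matrix with orthogonal rows of equal norm is a
  multiple of a unitary one; so the sum over the rows that are used is the
  opposite of the one missing term, which is unimodular.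

Since the squared scale (k - 1) / (v - 1) is 1 / r, columns have unit norm and
distinct columns have inner products of modulus 1 / r ([design_frame_etf]).  The
size 1 + r, one more than the number of blocks through a point, is what makes
the last two cases agree.

The density is r / M = k / v, by counting the incident pairs, and the formulas
for h = 1 + r, M, N = v h and N / M follow from r (k - 1) = v - 1 and M k = v r.  The
complex frame exists because the discrete Fourier matrix is a complex Hadamard
matrix of any size; the real one because a real Hadamard matrix only produces
entries that are real multiples of its own. *)

(** * Counting in a Steiner system *)

Section SteinerCounting.
Variables (k v : nat) (V : finType) (B : {set {set V}}).
Hypothesis hB : steiner_system k v B.

Lemma steiner_pair (x y : V) : x != y ->
  exists b, [/\ b \in B, x \in b, y \in b &
    forall b', b' \in B -> x \in b' -> y \in b' -> b' = b].
Proof.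
case: hB => _ _ _ hp xy.
have /hp[b [[bB sb] ub]] : #|[set x; y]| = 2 by rewrite cards2 xy.
move: sb; rewrite subUset !sub1set => /andP[xb yb].
exists b; split=> // b' b'B xb' yb'; apply/esym/ub; split=> //.
by rewrite subUset !sub1set xb' yb'.
Qed.

(** Double counting of the pairs (b, y) with b a block through x and y another
point of b: a block accounts for k - 1 of them, and a point y for exactly one. *)
Lemma steiner_degree x : (#|[set b in B | x \in b]| * (k - 1) = v - 1)%N.
Proof.
have [_ cV ck _] := hB.
have <- : (\sum_(b in [set b in B | x \in b]) #|b :\ x|
           = #|[set b in B | x \in b]| * (k - 1))%N.
  rewrite -sum_nat_const; apply: eq_bigr => b; rewrite inE => /andP[bB xb].
  by rewrite -(ck b bB) (cardsD1 x b) xb add1n subn1.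
have -> : (v - 1 = #|[set~ x]|)%N by rewrite cardsC1 cV subn1.
under eq_bigr do rewrite -sum1_card big_mkcond /=.
rewrite exchange_big -sum1_card [RHS]big_mkcond /=.
apply: eq_bigr => y _; rewrite !inE.
have [->|yx] /= := eqVneq y x; first by rewrite big1 // => b _; rewrite !inE eqxx.
have [b [bB yb xb ub]] := steiner_pair yx.
rewrite (bigD1 b) /= ?inE ?bB // yx yb big1 // => b'.
rewrite !inE yx /= => /andP[/andP[b'B xb'] nb'].
by case: ifP => // yb'; rewrite (ub b') ?eqxx in nb'.
Qed.

(** Double counting of the incident pairs (block, point). *)
Lemma steiner_double_count (r : nat) :
  (forall x, #|[set b in B | x \in b]| = r) -> (#|B| * k = v * r)%N.
Proof.
have [_ cV ck _] := hB => hr.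
rewrite -sum_nat_const -cV.
rewrite (eq_bigr (fun b : {set V} => \sum_x (if x \in b then 1 else 0))%N); last first.
  by move=> b bB; rewrite -(ck b bB) -sum1_card big_mkcond.
rewrite exchange_big /= -sum_nat_const; apply: eq_bigr => x _.
by rewrite -big_mkcondr -(hr x) -sum1_card /=; apply: eq_bigl => b; rewrite inE.
Qed.

Local Notation r := ((v - 1) %/ (k - 1))%N.

Lemma steiner_parameters :
  [/\ (0 < r)%N, (r * (k - 1) = v - 1)%N,
      (#|B| = (v * (v - 1)) %/ (k * (k - 1)))%N, (#|B| * k = v * r)%N &
      forall x, #|[set b in B | x \in b]| = r].
Proof.
have [/andP[k2 kv] cV _ _] := hB.
have k1 : (0 < k - 1)%N by lia.
have deg x : #|[set b in B | x \in b]| = r.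
  by rewrite -(steiner_degree x) mulnK.
have rk : (r * (k - 1) = v - 1)%N.
  have /card_gt0P[x _] : (0 < #|V|)%N by lia.
  by rewrite -(deg x) steiner_degree.
have dc := steiner_double_count deg.
split=> //; first by rewrite divn_gt0 //; lia.
by rewrite -{1}rk mulnA -dc -mulnA mulnK // muln_gt0 k1; lia.
Qed.

Lemma steiner_incidence_exists (M : nat) :
  #|B| = M -> exists A : 'M[nat]_(v, M), incidence_matrix B A.
Proof.
move=> <-; have [_ <- _ _] := hB.
exists (\matrix_(j, i) nat_of_bool (enum_val j \in (enum_val i : {set V}))).
exists enum_val, enum_val; split=> //.
- exact: enum_val_bij.
- exact: enum_val_inj.
move=> b; split=> [bB|[i <-]]; last exact: enum_valP.
by exists (enum_rank_in bB b); rewrite enum_rankK_in.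
Qed.

End SteinerCounting.

(** * Complex Hadamard matrices *)

(** The hypothesis n != 0 in F makes X^n - 1 separable, so that its n distinct roots
form a cyclic group of order n. *)
Lemma prim_root_exists (F : closedFieldType) n :
  (0 < n)%N -> n%:R != 0 :> F -> exists z : F, n.-primitive_root z.
Proof.
move=> n_gt0 nF.
have [rs] := closed_field_poly_normal ('X^n - 1 : {poly F}).
rewrite (monicP (monicXnsubC 1 n_gt0)) scale1r => Drs.
suff /hasP[z _ pz] : has n.-primitive_root rs by exists z.
apply: has_prim_root => //.
- by apply/allP => z; rewrite -root_prod_XsubC -Drs.
- by rewrite -separable_prod_XsubC -Drs separable_Xn_sub_1.
- by rewrite -ltnS -(size_prod_XsubC rs id) -Drs size_XnsubC.
Qed.

Section Hermitian.
Variable C : numClosedFieldType.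

Lemma dotmx_sum n (x y : 'rV[C]_n) : dotmx x y = \sum_j x 0 j * (y 0 j)^*.
Proof. by rewrite dotmxE mxE; apply: eq_bigr => j _; rewrite !mxE. Qed.

Lemma dotmx_row m n (A : 'M[C]_(m, n)) i i' :
  dotmx (row i A) (row i' A) = \sum_j A i j * (A i' j)^*.
Proof. by rewrite dotmx_sum; apply: eq_bigr => j _; rewrite !mxE. Qed.

Lemma dotmx_col m n (A : 'M[C]_(m, n)) j j' :
  dotmx (col j A)^T (col j' A)^T = \sum_i A i j * (A i j')^*.
Proof. by rewrite dotmx_sum; apply: eq_bigr => i _; rewrite !mxE. Qed.

Lemma unimodular_mul_conj (x : C) : `|x| = 1 -> x * x^* = 1.
Proof. by move=> x1; rewrite -normCK x1 expr1n. Qed.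

(** A square matrix with H H^* = n I also satisfies H^* H = n I, because a right
inverse of a square matrix is a left inverse. *)
Lemma hadamard_cols_orthogonal n (H : 'M[C]_n) l l' :
  complex_hadamard H -> l != l' -> \sum_i H i l * (H i l')^* = 0.
Proof.
move=> [H1 H0] ll'.
have n0 : n%:R != 0 :> C by rewrite pnatr_eq0; case: (n) l {H H1 H0 ll'} => [[]|].
pose Hs : 'M[C]_n := \matrix_(l, i) (H i l)^*.
have HHs : H *m (n%:R^-1 *: Hs) = 1%:M.
  apply/matrixP => i i'; rewrite -scalemxAr !mxE.
  under eq_bigr do rewrite mxE.
  have [->|ii'] := eqVneq i i'.
    rewrite (eq_bigr (fun=> 1)) => [|j _]; last by rewrite unimodular_mul_conj.
    by rewrite sumr_const card_ord mulVf.
  by have := H0 _ _ ii'; rewrite dotmx_row => ->; rewrite mulr0.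
have /matrixP/(_ l' l) := mulmx1C HHs.
rewrite -scalemxAl !mxE eq_sym (negPf ll') => /eqP.
rewrite mulf_eq0 invr_eq0 (negPf n0) /= => /eqP HsH; rewrite -[RHS]HsH.
by apply: eq_bigr => i _; rewrite mxE mulrC.
Qed.

(** The witness is the discrete Fourier matrix z^(i l), with z a primitive n-th root
of unity: two of its rows multiply to a geometric sum of ratio w = z^(i - i'),
which vanishes as w is an n-th root of unity other than 1. *)
Lemma complex_hadamard_exists n : exists H : 'M[C]_n, complex_hadamard H.
Proof.
case: n => [|n]; first by exists 0; split=> [[]|[]].
have [|z pz] := prim_root_exists (F := C) (ltn0Sn n); first by rewrite pnatr_eq0.
have zn := prim_expr_order pz.
have z1 : `|z| = 1.
  by apply/eqP; rewrite -(@pexpr_eq1 _ _ n.+1) // -normrX zn normr1.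
have zz : z * z^* = 1 by exact: unimodular_mul_conj.
exists (\matrix_(i, l) z ^+ (i * l)); split=> [i l|i i' ii'].
  by rewrite mxE normrX z1 expr1n.
rewrite dotmx_row.
(* z^* is the inverse of z, so w is z ^ (i - i') with no sign restriction. *)
pose w := z ^+ i * (z^*) ^+ i'.
have wn : w ^+ n.+1 = 1.
  rewrite exprMn -!exprM ![(_ * n.+1)%N]mulnC !exprM -rmorphXn zn.
  by rewrite rmorph1 !expr1n mulr1.
have w1 : w - 1 != 0.
  apply: contra ii'; rewrite subr_eq0 => /eqP w1.
  have : z ^+ i = z ^+ i'.
    rewrite -[LHS]mulr1 -(expr1n _ i') -zz mulrC exprMn -mulrA.
    by rewrite [X in _ * X]mulrC -/w w1 mulr1.
  by move/eqP; rewrite (eq_prim_root_expr pz) /eqn !modn_small.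
apply: (mulfI w1); rewrite mulr0.
transitivity (w ^+ n.+1 - 1); last by rewrite wn subrr.
rewrite subrX1; congr (_ * _).
by apply: eq_bigr => l _; rewrite !mxE rmorphXn !exprM -exprMn.
Qed.

End Hermitian.

Lemma real_hadamard_complex (R : rcfType) n (H : 'M[R]_n) :
  real_hadamard H -> complex_hadamard (map_mx (real_complex R) H).
Proof.
move=> [H1 H0]; split=> [i l|i i' ii'].
  by rewrite mxE; case: (H1 i l) => ->; rewrite ?rmorphN rmorph1 ?normrN normr1.
have := congr1 (real_complex R) (H0 _ _ ii'); rewrite rmorph0 rmorph_sum => <-.
rewrite dotmx_row.
apply: eq_bigr => l _; rewrite !mxE rmorphM; congr (_ * _).
by rewrite conj_Creal // complex_real.
Qed.

(** * Concatenated blocks of columns *)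

Section Concatenation.
Variables (v n : nat).

Definition block_index (j : 'I_v) (l : 'I_n) : 'I_(v * n) :=
  cast_ord (sum_const_ord v n) (tagnat.Rank (p_ := fun=> n) j l).

Lemma concatenate_block_index (C : numClosedFieldType) M
    (Phi_ : 'I_v -> 'M[C]_(M, n)) i j l :
  concatenate Phi_ i (block_index j l) = Phi_ j i l.
Proof.
rewrite castmxE cast_ordK cast_ord_id.
by have /matrixP/(_ i l) := mxrowK Phi_ j; rewrite mxE.
Qed.

Lemma block_index_surj m : exists j l, m = block_index j l.
Proof.
exists (tagnat.sig1 (cast_ord (esym (sum_const_ord v n)) m)).
exists (tagnat.sig2 (cast_ord (esym (sum_const_ord v n)) m)).
by rewrite /block_index tagnat.sig2K cast_ordKV.
Qed.

(** Turns every row product and every count over the columns of a concatenation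
into a double sum, over the groups of columns and inside a group. *)
Lemma big_block_index (T : Type) (idx : T) (op : Monoid.com_law idx)
    (F : 'I_(v * n) -> T) :
  \big[op/idx]_m F m = \big[op/idx]_j \big[op/idx]_l F (block_index j l).
Proof.
have cast_bij := Bijective (cast_ordK (sum_const_ord v n)) (cast_ordKV _).
rewrite sig_big_dep /= (reindex _ (onW_bij _ cast_bij)).
rewrite (reindex _ (onW_bij _ (tagnat.rank_bij (p_ := fun=> n)))) /=.
by apply: eq_bigr => p _; rewrite tagnat.rankE.
Qed.

End Concatenation.

(** * Equiangular tight frames from designs *)

Section DesignFrame.
(** Points and blocks are seen only through the relation [inc j i], the point j lies on
the block i, because the frame conditions only involve the numbers of points on a
block, of blocks through a point, and of blocks through two points. *)
Variables (C : numClosedFieldType) (v M k r n : nat) (c : C).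
Variables (inc : 'I_v -> 'I_M -> bool) (H : 'I_v -> 'M[C]_n).
Variables (s : 'I_v -> 'I_M -> 'I_n) (Phi : 'M[C]_(M, v * n)).

Hypothesis k_gt0 : (0 < k)%N.
Hypothesis r_gt0 : (0 < r)%N.
Hypothesis block_size : forall i, #|[set j | inc j i]| = k.
Hypothesis PhiE : forall i j l,
  Phi i (block_index j l) = c * (if inc j i then H j (s j i) l else 0).
Hypothesis hadH : forall j, complex_hadamard (H j).
Hypothesis c_neq0 : c != 0.

(** Each incident pair (i, j) accounts for a whole row of H j, whose n entries are
unimodular and therefore nonzero. *)
Lemma design_frame_nonzero_count :
  #|[set p : 'I_M * 'I_(v * n) | Phi p.1 p.2 != 0]| = (M * (k * n))%N.
Proof.
rewrite -sum1_card (eq_bigl (fun p => true && (Phi p.1 p.2 != 0))); last first.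
  by move=> p; rewrite inE.
rewrite -(pair_big_dep xpredT (fun i m => Phi i m != 0) (fun _ _ => 1%N)) /=.
rewrite -[in RHS](card_ord M) -sum_nat_const; apply: eq_bigr => i _.
rewrite big_mkcond big_block_index -(block_size i) -sum_nat_const.
rewrite [RHS]big_mkcond; apply: eq_bigr => j _; rewrite inE.
rewrite (eq_bigr (fun=> if inc j i then 1 else 0)%N) => [|l _].
  by rewrite sum_nat_const card_ord; case: inc; rewrite ?muln0 ?muln1.
rewrite PhiE mulf_eq0 (negPf c_neq0); case: inc => /=; last by rewrite eqxx.
have [+ _] := hadH j; move=> /(_ (s j i) l) H1.
by rewrite -normr_eq0 H1 oner_eq0.
Qed.

Hypothesis degree : forall j, #|[set i | inc j i]| = r.
Hypothesis nE : n = r.+1.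
Hypothesis meet : forall j j', j != j' ->
  exists i, [/\ inc j i, inc j' i & forall i', inc j i' -> inc j' i' -> i' = i].
Hypothesis s_inj : forall j, {in inc j &, injective (s j)}.
Hypothesis normc : `|c| ^+ 2 = r%:R^-1.

Lemma design_frame_term i i' j j' l l' :
  Phi i (block_index j l) * (Phi i' (block_index j' l'))^* =
  if inc j i && inc j' i'
  then r%:R^-1 * (H j (s j i) l * (H j' (s j' i') l')^*) else 0.
Proof.
rewrite !PhiE rmorphM mulrACA -normCK normc.
by do 2!case: inc; rewrite ?mul0r ?rmorph0 ?mulr0.
Qed.

(** For i != i' each point incident with both gives the product of two rows of one
Hadamard matrix, and [s_inj] says that they are different rows. *)
Lemma design_frame_rows i i' :
  dotmx (row i Phi) (row i' Phi) =
  (i == i')%:R * (r%:R^-1 * (k * n)%:R).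
Proof.
rewrite dotmx_row big_block_index /=.
have [<-|ii'] := eqVneq i i'; rewrite ?mul0r ?mul1r.
  rewrite natrM mulrA -(block_size i) -[#|_|]sum1_card natr_sum mulr_sumr mulr_suml.
  rewrite [RHS]big_mkcond; apply: eq_bigr => j _; rewrite inE.
  under eq_bigr do rewrite design_frame_term andbb.
  case: ifP => _; last by rewrite big1.
  rewrite mulr1 -mulr_sumr; congr (_ * _).
  rewrite (eq_bigr (fun=> 1)) ?sumr_const ?card_ord // => l _.
  by apply: unimodular_mul_conj; have [+ _] := hadH j; apply.
rewrite big1 // => j _; under eq_bigr do rewrite design_frame_term.
have [/andP[ji ji']|_] := boolP (inc j i && inc j i'); last by rewrite big1.
rewrite -mulr_sumr; have [_] := hadH j => /(_ (s j i) (s j i')).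
rewrite dotmx_row => ->; rewrite ?mulr0 //.
by apply: contra ii' => /eqP/s_inj->.
Qed.

Lemma norm_hadamard_term j j' a a' l l' : `|H j a l * (H j' a' l')^*| = 1.
Proof.
have [Hj _] := hadH j; have [Hj' _] := hadH j'.
by rewrite normrM norm_conjC Hj Hj' mulr1.
Qed.

Lemma design_frame_col_norm m : dotmx (col m Phi)^T (col m Phi)^T = 1.
Proof.
have [j [l ->]] := block_index_surj m; rewrite dotmx_col.
under eq_bigr do rewrite design_frame_term andbb.
rewrite -big_mkcond (eq_bigr (fun=> r%:R^-1)) => [|i _].
  rewrite sumr_const (eq_card (B := [set i | inc j i])) => [|i]; last by rewrite inE.
  by rewrite degree -[_ *+ r]mulr_natr mulVf // pnatr_eq0 -lt0n.
by rewrite unimodular_mul_conj ?mulr1 //; have [+ _] := hadH j; apply.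
Qed.

(** The r values of [s j] on the blocks through j omit exactly one index a of the
r + 1 rows, and the full column product is zero; so the product over the used rows is
minus the unimodular term of row a. *)
Lemma design_frame_same_block j l l' : l != l' ->
  `|dotmx (col (block_index j l) Phi)^T (col (block_index j l') Phi)^T| = r%:R^-1.
Proof.
move=> ll'; rewrite dotmx_col.
under eq_bigr do rewrite design_frame_term andbb.
rewrite -big_mkcond -mulr_sumr normrM normfV normr_nat -[RHS]mulr1; congr (_ * _).
set S := [set i | inc j i].
have cS : #|s j @: S| = r.
  by rewrite card_in_imset ?degree // => i i'; rewrite !inE => ji ji'; apply: s_inj.
have /cards1P[a Sa] : #|~: (s j @: S)| == 1%N.
  by rewrite cardsCs setCK card_ord cS {1}nE subSnn.
rewrite (eq_bigl (fun i => i \in S)) => [|i]; last by rewrite inE.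
rewrite -(big_imset (fun a => H j a l * (H j a l')^*)) /=; last first.
  by move=> i i'; rewrite !inE => ji ji'; apply: s_inj.
have := hadamard_cols_orthogonal (hadH j) ll'.
rewrite (bigID (mem (s j @: S))) /= => /eqP; rewrite addr_eq0 => /eqP ->.
rewrite (big_pred1 a) => [|b]; first by rewrite normrN norm_hadamard_term.
by have := in_set1 b a; rewrite -Sa inE.
Qed.

(** Exactly one row has a nonzero entry in both columns. *)
Lemma design_frame_other_block j j' l l' : j != j' ->
  `|dotmx (col (block_index j l) Phi)^T (col (block_index j' l') Phi)^T| = r%:R^-1.
Proof.
move=> /meet[i [ji j'i ui]]; rewrite dotmx_col.
under eq_bigr do rewrite design_frame_term.
rewrite -big_mkcond (big_pred1 i) => [|i'].
  by rewrite normrM norm_hadamard_term normfV normr_nat mulr1.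
by apply/andP/eqP => [[]|->//]; apply: ui.
Qed.

Lemma design_frame_etf : equiangular_tight_frame Phi.
Proof.
have n_gt0 : (0 < n)%N by rewrite nE.
have rows i : dotmx (row i Phi) (row i Phi) = r%:R^-1 * (k * n)%:R.
  by rewrite design_frame_rows eqxx mul1r.
split=> [i|i i'|i i' ii'|m|].
- apply/eqP => Pi0; have /eqP := rows i; rewrite Pi0 dotmx_sum big1 => [|m _].
    by rewrite eq_sym mulf_eq0 invr_eq0 !pnatr_eq0 muln_eq0 !gtn_eqF.
  by rewrite mxE mul0r.
- by rewrite /l2norm !rows.
- by rewrite design_frame_rows (negPf ii') mul0r.
- by rewrite /l2norm design_frame_col_norm sqrtC1.
exists r%:R^-1 => m m'.
have [j [l ->]] := block_index_surj m; have [j' [l' ->]] := block_index_surj m'.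
have [<- bb|jj' _] := eqVneq j j'; last exact: design_frame_other_block.
by apply: design_frame_same_block; apply: contra bb => /eqP ->.
Qed.

End DesignFrame.

(** * The Steiner construction *)

Lemma distinct_rows_exists M n (c : 'cV[nat]_M) :
  (#|[set i | c i 0%R == 1]| < n)%N ->
  exists s : 'I_M -> 'I_n, distinct_rows c s.
Proof.
case: n => // n; rewrite ltnS => cn; set S := [set i | _] in cn.
(* Entries outside S may get the same row as an entry of S; injectivity only
   concerns S. *)
exists (fun i => inord (index i (enum S))) => i i'.
have idx x : c x 0 == 1%N -> (x \in enum S) * (index x (enum S) < n.+1)%N.
  move=> cx; have xS : x \in enum S by rewrite mem_enum inE.
  by split=> //; rewrite ltnS (leq_trans _ cn) // cardE ltnW // index_mem.
rewrite !inE => /idx[iS i_lt] /idx[i'S i'_lt] /(congr1 val).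
by rewrite /= !inordK //; apply: index_inj.
Qed.

Section SteinerConstruction.
Variables (k v : nat) (V : finType) (B : {set {set V}}).
Hypothesis hB : steiner_system k v B.
Variable M : nat.

Local Notation r := ((v - 1) %/ (k - 1))%N.

(** Carries the combinatorics from points and blocks over to the indices given by the
enumerations that define A. *)
Lemma incidence_design (A : 'M[nat]_(v, M)) : incidence_matrix B A ->
  [/\ forall i, #|[set j | A j i == 1%N]| = k,
      forall j, #|[set i | A j i == 1%N]| = r
    & forall j j', j != j' -> exists i, [/\ A j i == 1%N, A j' i == 1%N &
        forall i', A j i' == 1%N -> A j' i' == 1%N -> i' = i]].
Proof.
move=> [pt [bl [pt_bij bl_inj blB ->]]].
have [_ _ _ _ deg] := steiner_parameters hB.
have [_ _ ck _] := hB.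
have incE j i : ((\matrix_(j, i) nat_of_bool (pt j \in bl i)) j i == 1%N)
    = (pt j \in bl i) by rewrite mxE eqb1.
split=> [i|j|j j' jj'].
- have <- : #|bl i| = k by apply: ck; apply/blB; exists i.
  rewrite -(on_card_preimset (onW_bij _ pt_bij)).
  by apply: eq_card => j; rewrite !inE incE.
- rewrite -(deg (pt j)) -(card_imset _ bl_inj); apply: eq_card => b.
  apply/imsetP/idP => [[i + ->]|]; rewrite !inE.
    by rewrite incE => ->; rewrite andbT; apply/blB; exists i.
  by case/andP => /blB[i <-] ji; exists i; rewrite ?inE ?incE.
have [b [bB jb j'b ub]] : exists b, [/\ b \in B, pt j \in b, pt j' \in b &
    forall b', b' \in B -> pt j \in b' -> pt j' \in b' -> b' = b].
  by apply: (steiner_pair hB); rewrite (bij_eq pt_bij).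
have [i bli] := (blB b).1 bB; exists i; rewrite !incE bli; split=> // i'.
rewrite !incE => ji' j'i'; apply/bl_inj; rewrite bli; apply: ub => //.
by apply/blB; exists i'.
Qed.

(** This is what normalizes the columns, each of which has r unimodular entries
before rescaling. *)
Lemma steiner_scale (F : numFieldType) : (k%:R - 1) / (v%:R - 1) = r%:R^-1 :> F.
Proof.
have [/andP[k2 kv] _ _ _] := hB; have [r0 rk _ _ _] := steiner_parameters hB.
have pred_natr m : (0 < m)%N -> m%:R - 1 = (m - 1)%:R :> F by move=> m0; rewrite natrB.
rewrite !pred_natr; try lia.
rewrite -[in LHS]rk natrM invfM mulrCA mulfV ?mulr1 // pnatr_eq0; lia.
Qed.

Section ClosedField.
Variable C : numClosedFieldType.

Lemma steiner_construction_exists (A : 'M[nat]_(v, M)) (H : 'I_v -> 'M[C]_r.+1) :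
  incidence_matrix B A -> exists Phi, steiner_construction k A H Phi.
Proof.
move=> /incidence_design[_ deg _].
have S j : exists s : 'I_M -> 'I_r.+1, distinct_rows (col j A^T) s.
  apply: distinct_rows_exists; rewrite ltnS -(deg j) eq_leq //.
  by apply: eq_card => i; rewrite !inE !mxE.
have [s s_inj] := fin_all_exists S.
by eexists; exists s; split; first exact: s_inj.
Qed.

Lemma steiner_construction_etf (A : 'M[nat]_(v, M)) (H : 'I_v -> 'M[C]_r.+1) Phi :
  incidence_matrix B A -> (forall j, complex_hadamard (H j)) ->
  steiner_construction k A H Phi ->
  equiangular_tight_frame Phi /\
  #|[set p : 'I_M * 'I_(v * r.+1) | Phi p.1 p.2 != 0]| = (M * (k * r.+1))%N.
Proof.
move=> incA hadH [s [s_inj ->]].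
have [bsize deg meet] := incidence_design incA.
have [/andP[k2 kv] _ _ _] := hB; have [r0 _ _ _ _] := steiner_parameters hB.
rewrite steiner_scale; set Psi := _ *: _.
have r1 : r%:R^-1 != 0 :> C by rewrite invr_eq0 pnatr_eq0 -lt0n.
have PsiE i j l : Psi i (block_index j l) =
    sqrtC r%:R^-1 * (if A j i == 1%N then H j (s j i) l else 0).
  by rewrite mxE concatenate_block_index !mxE.
split; last by apply: design_frame_nonzero_count bsize PsiE hadH _; rewrite sqrtC_eq0.
apply: design_frame_etf r0 bsize PsiE hadH deg _ meet _ _ => //; first lia.
- by move=> j i i' ji ji'; apply: s_inj; rewrite inE !mxE.
by rewrite -normrX sqrtCK normfV normr_nat.
Qed.

End ClosedField.

Hypothesis BM : #|B| = M.

Lemma steiner_density (F K : numFieldType) (Phi : 'M[K]_(M, v * r.+1)) :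
  #|[set p : 'I_M * 'I_(v * r.+1) | Phi p.1 p.2 != 0]| = (M * (k * r.+1))%N ->
  density F Phi = k%:R / v%:R.
Proof.
have [/andP[k2 kv] _ _ _] := hB; have [r0 _ _ dc _] := steiner_parameters hB.
have M_gt0 : (0 < M)%N.
  have : (0 < #|B| * k)%N by rewrite dc muln_gt0 r0 andbT; lia.
  by rewrite BM muln_gt0 => /andP[].
rewrite /density => ->; rewrite !natrM -!mulf_div !mulfV ?mul1r ?mulr1 //.
all: by rewrite pnatr_eq0 -lt0n.
Qed.

(** Every entry is the real number sqrt (1 / r) times zero or an entry of H, so taking
real parts recovers the matrix. *)
Lemma steiner_construction_real (R : rcfType) (A : 'M[nat]_(v, M))
    (H : 'M[R]_r.+1) (Phi : 'M[R[i]]_(M, v * r.+1)) :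
  steiner_construction k A (fun=> map_mx (real_complex R) H) Phi ->
  exists Psi : 'M[R]_(M, v * r.+1), Phi = map_mx (real_complex R) Psi.
Proof.
move=> [s [_ ->]]; rewrite steiner_scale.
set c := sqrtC _.
have c_real : c \is Num.real by rewrite ger0_real // sqrtC_ge0 invr_ge0 ler0n.
exists (map_mx (@complex.Re R) (c *: concatenate
  (fun j => substitute_rows (col j A^T) (s j) (map_mx (real_complex R) H)))).
apply/matrixP => i m; have [j [l ->]] := block_index_surj m.
rewrite !mxE concatenate_block_index !mxE RRe_real // realM //.
by case: ifP => _; rewrite ?complex_real ?real0.
Qed.

End SteinerConstruction.

(** * Size, redundancy and density *)

Lemma steiner_frame_parameters (R : rcfType) (k v : nat) (V : finType)
    (B : {set {set V}}) : steiner_system k v B ->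
  let r := ((v - 1) %/ (k - 1))%N in
  let M := #|B| in
  let N := (v * r.+1)%N in
  [/\ r.+1%:R = 1 + (v%:R - 1) / (k%:R - 1) :> R,
      M%:R = (v%:R * (v%:R - 1)) / (k%:R * (k%:R - 1)) :> R,
      N%:R = v%:R * (1 + (v%:R - 1) / (k%:R - 1)) :> R,
      N%:R / M%:R = k%:R * (1 + (k%:R - 1) / (v%:R - 1)) :> R
    & k%:R / v%:R = Num.sqrt ((N%:R - 1) / (M%:R * (N%:R - M%:R))) :> R].
Proof.
move=> hB r M N.
have [/andP[k2 kv] _ _ _] := hB; have [r0 rk _ dc _] := steiner_parameters hB.
have k2R : 2 <= k%:R :> R by rewrite ler_nat.
have r1R : 1 <= r%:R :> R by rewrite ler1n.
have vE : v%:R = r%:R * (k%:R - 1) + 1 :> R.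
  rewrite -(natrB _ (n := 1%N)); last lia.
  by rewrite -natrM rk natrB ?subrK //; lia.
have v2R : 2 <= v%:R :> R by rewrite ler_nat; lia.
have ME : M%:R = v%:R * r%:R / k%:R :> R.
  rewrite -natrM -dc natrM mulfK //; apply: lt0r_neq0; lra.
have NE : N%:R = v%:R * (1 + r%:R) :> R by rewrite natrM -nat1r.
have rE : (v%:R - 1) / (k%:R - 1) = r%:R :> R.
  by rewrite vE addrK mulfK //; apply: lt0r_neq0; lra.
have nz (x : R) : 0 < x -> x != 0 := @lt0r_neq0 _ x.
split.
- by rewrite rE nat1r.
- by rewrite invfM mulrACA rE ME; ring.
- by rewrite rE NE.
- rewrite NE ME vE; field; rewrite -?vE; repeat (apply/andP; split); apply: nz; nra.
(* N - M = v (k + v - 1) / k and N - 1 = r (k + v - 1), as r (k - 1) = v - 1. *)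
have -> : (N%:R - 1) / (M%:R * (N%:R - M%:R)) = (k%:R / v%:R) ^+ 2 :> R.
  rewrite NE ME vE; field; rewrite -?vE; repeat (apply/andP; split); apply: nz; nra.
by rewrite sqrtr_sqr ger0_norm // divr_ge0 ?ler0n.
Qed.

Theorem theorem7 (R : realType) (k v : nat) (V : finType) (B : {set {set V}})
    (hB : steiner_system k v B) :
  let h := (1 + (v - 1) %/ (k - 1))%N in
  let M := ((v * (v - 1)) %/ (k * (k - 1)))%N in
  let N := (v * h)%N in
  [/\ (h%:R = 1 + (v%:R - 1) / (k%:R - 1) :> R) /\
      (M%:R = (v%:R * (v%:R - 1)) / (k%:R * (k%:R - 1)) :> R) /\
      (N%:R = v%:R * (1 + (v%:R - 1) / (k%:R - 1)) :> R),
      (N%:R / M%:R = k%:R * (1 + (k%:R - 1) / (v%:R - 1)) :> R) /\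
      (k%:R / v%:R =
         Num.sqrt ((N%:R - 1) / (M%:R * (N%:R - M%:R))) :> R),
      (exists Phi : 'M[R[i]]_(M, N),
         [/\ steiner_generates k B Phi,
             equiangular_tight_frame Phi
           & density R Phi = k%:R / v%:R]),
      ((exists H : 'M[R]_h, real_hadamard H) ->
       exists Phi : 'M[R]_(M, N),
         let PhiC := map_mx (real_complex R) Phi in
         [/\ steiner_generates k B PhiC,
             equiangular_tight_frame PhiC
           & density R PhiC = k%:R / v%:R])
    & (forall (A : 'M[nat]_(v, M)) (H : 'I_v -> 'M[R[i]]_h),
         incidence_matrix B A ->
         (forall j, complex_hadamard (H j)) ->
         (exists Phi : 'M[R[i]]_(M, N), steiner_construction k A H Phi) /\
         (forall Phi : 'M[R[i]]_(M, N), steiner_construction k A H Phi ->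
            equiangular_tight_frame Phi /\ density R Phi = k%:R / v%:R))].
Proof.
rewrite add1n => h M N.
have [_ _ BM _ _] := steiner_parameters hB; rewrite -/M in BM.
have [hE ME NE redE densE] := steiner_frame_parameters R hB.
rewrite BM -/h in hE ME NE redE densE.
have frame (A : 'M[nat]_(v, M)) (H : 'I_v -> 'M[R[i]]_h) Phi :
    incidence_matrix B A -> (forall j, complex_hadamard (H j)) ->
    steiner_construction k A H Phi ->
    equiangular_tight_frame Phi /\ density R Phi = k%:R / v%:R.
  move=> incA hadH /(steiner_construction_etf hB incA hadH)[etf nz].
  by split=> //; apply: (steiner_density hB BM).
have [A incA] := steiner_incidence_exists hB BM.
split=> [||| [H hadH] | A' H incA' hadH]; first by split.
- by split.
- have [H hadH] := complex_hadamard_exists R[i] h.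
  have [Phi consPhi] := steiner_construction_exists hB (fun=> H) incA.
  have [] := frame _ _ _ incA (fun=> hadH) consPhi.
  by exists Phi; split=> //; exists A, (fun=> H).
- have hadHC := real_hadamard_complex hadH.
  have [PhiC consPhi] :=
    steiner_construction_exists hB (fun=> map_mx (real_complex R) H) incA.
  have [Phi PhiE] := steiner_construction_real hB consPhi.
  rewrite PhiE in consPhi; have [] := frame _ _ _ incA (fun=> hadHC) consPhi.
  by exists Phi; split=> //; exists A, (fun=> map_mx (real_complex R) H).
split=> [|Phi]; first exact: (steiner_construction_exists hB H incA').
exact: frame incA' hadH.
Qed.
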